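(* Let $\mathbb U$ and $\mathbb V$ be Banach spaces with $\dim\mathbb V\ge2$, and let $B:\mathbb U\to\mathbb V^*$ be a linear operator with $\gamma_B\|w\|_{\mathbb U}\le\|Bw\|_{\mathbb V^*}\le M_B\|w\|_{\mathbb U}$ for all $w\in\mathbb U$, where $M_B>0$ and $\gamma_B>0$. Given $f\in\mathbb V^*$ and a finite-dimensional subspace $\mathbb U_n\subset\mathbb U$, the following hold: (i) There exists a residual minimizer $u_n\in\mathbb U_n$, i.e. $\|f-Bu_n\|_{\mathbb V^*}=\min_{w_n\in\mathbb U_n}\|f-Bw_n\|_{\mathbb V^*}$. (ii) Any residual minimizer $u_n$ satisfies the a priori bounds $$\|u_n\|_{\mathbb U}\le\frac{C_{\mathrm{BM}}(\mathbb V^* )}{\gamma_B}\|f\|_{\mathbb V^*}\qquad\text{and}\qquad \|u_n\|_{\mathbb U}\le\frac{1+C_{\mathrm{AO}}(\mathbb V)}{\gamma_B}\|f\|_{\mathbb V^*},$$ where $C_{\mathrm{BM}}(\mathbb V^* )$ is the Banach--Mazur constant of $\mathbb V^*$ and $C_{\mathrm{AO}}(\mathbb V)$ is the asymmetric-orthogonality constant of $\mathbb V$. (iii) If $\mathbb V^*$ is strictly convex, then the residual minimizer is unique. (iv) If $f\in\mathrm{Im}(B)$ and $u\in\mathbb U$ is the solution of $Bu=f$, then any residual minimizer $u_n$ satisfies $$\|u-u_n\|_{\mathbb U}\le\frac1{\gamma_B}\|f-Bu_n\|_{\mathbb V^*}\le\frac{M_B}{\gamma_B}\inf_{w_n\in\mathbb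 U_n}\|u-w_n\|_{\mathbb U}.$$
   Context: All spaces are real. For a normed space $\mathbb Y$, the duality mapping is $\mathcal J_{\mathbb Y}(y)=\{y^*\in\mathbb Y^*:\langle y^*,y\rangle=\|y\|_{\mathbb Y}^2=\|y^*\|_{\mathbb Y^*}^2\}$. A normed space is strictly convex if $\|\theta y_1+(1-\theta)y_2\|<1$ whenever $y_1\ne y_2$, $\|y_1\|=\|y_2\|=1$, $\theta\in(0,1)$. Banach--Mazur constant (for $\dim\mathbb Y\ge2$): $C_{\mathrm{BM}}(\mathbb Y):=\sup\{d_{\mathrm{BM}}(\mathbb W,\ell_2(\mathbb R^2))^2:\mathbb W\subset\mathbb Y\text{ a subspace},\ \dim\mathbb W=2\}$, where $d_{\mathrm{BM}}(\mathbb W,\ell_2(\mathbb R^2)):=\inf\{\|T\|\,\|T^{-1}\|: T:\mathbb W\to\ell_2(\mathbb R^2)\text{ a linear isomorphism}\}$ and $\ell_2(\mathbb R^2)$ is $\mathbb R^2$ with the Euclidean norm. It is known that $1\le C_{\mathrm{BM}}(\mathbb Y)\le2$. Asymmetric-orthogonality constant (for $\dim\mathbb Y\ge2$): $$C_{\mathrm{AO}}(\mathbb Y):=\sup\left\{\frac{\langle z_0^*,z\rangle_{\mathbb Y^*,\mathbb Y}}{\|z\|_{\mathbb Y}\|z_0\|_{\mathbb Y}}:(z_0,z)\in\mathcal O_{\mathbb Y},\ z_0^*\in\mathcal J_{\mathbb Y}(z_0)\right\},$$ $\mathcal O_{\mathbb Y}:=\{(z_0,z)\in\mathbb Y\times\mathbb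 Y:\exists z^*\in\mathcal J_{\mathbb Y}(z)\text{ with }\langle z^*,z_0\rangle=0\}$ (the supremum being over nonzero $z_0,z$). One has $0\le C_{\mathrm{AO}}(\mathbb Y)\le1$. *)

(* Defs.v *)
From HB Require Import structures.
From mathcomp Require Import all_boot all_order all_algebra.
From mathcomp Require Import all_classical all_reals all_analysis.
From mathcomp Require Import ring lra.

Set Implicit Arguments.
Unset Strict Implicit.
Unset Printing Implicit Defensive.

Import Order.TTheory GRing.Theory Num.Theory.
Import numFieldNormedType.Exports.

Local Open Scope classical_set_scope.
Local Open Scope ring_scope.

Section Dimension.
Context {R : realType} (Y : lmodType R).

Definition lin_indep n (e : 'I_n -> Y) : Prop :=
  forall c : 'I_n -> R, \sum_(i < n) c i *: e i = 0 -> forall i, c i = 0.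

Definition spanning n (e : 'I_n -> Y) : Prop :=
  forall y : Y, exists c : 'I_n -> R, y = \sum_(i < n) c i *: e i.

Definition has_dim (n : nat) : Prop :=
  exists e : 'I_n -> Y, lin_indep e /\ spanning e.

Definition finite_dim : Prop := exists n, has_dim n.

(* [dim Y >= n]; [Y] may be infinite-dimensional. *)
Definition dim_ge (n : nat) : Prop := exists e : 'I_n -> Y, lin_indep e.

End Dimension.

(* Extended-real valued, so that an unbounded operator has norm [+oo]. *)
Definition opnorm {R : realType} {X Z : normedModType R} (T : X -> Z) : \bar R :=
  ereal_sup [set `|T x|%:E | x in [set x | `|x| <= 1]].

Section DualSpace.
Context {R : realType} (Y : normedModType R).

Definition cont_linear : {pred Y -> R^o} :=
  fun f => `[< linear f /\ continuous f >].

Lemma cont_linear_submod : submod_closed cont_linear.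
Proof.
split.
  apply/asboolP; split; last by move=> x; exact: cvg_cst.
  by move=> a x y; rewrite -[LHS]/(0 : R^o) -[RHS]/(a *: (0 : R^o) + 0) scaler0 addr0.
move=> a f g /asboolP[lf cf] /asboolP[lg cg]; apply/asboolP; split.
  move=> b x y; rewrite -[LHS]/(a *: f (b *: x + y) + g (b *: x + y)) lf lg.
  rewrite -[RHS]/(b *: (a *: f x + g x) + (a *: f y + g y)).
  by rewrite !scalerDr !scalerA (mulrC a) addrACA.
move=> x; apply: (@cvgD _ _ _ _ _ (fun x => a *: f x) g); last exact: cg.
by apply: cvgZr; exact: cf.
Qed.

HB.instance Definition _ :=
  GRing.isSubmodClosed.Build R (Y -> R^o) cont_linear cont_linear_submod.

Record dual := Dual { dual_fun :> Y -> R^o ; _ : dual_fun \in cont_linear }.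

HB.instance Definition _ := [isSub for dual_fun].
HB.instance Definition _ := [Choice of dual by <:].
HB.instance Definition _ := [SubChoice_isSubLmodule of dual by <:].

Lemma dual_linear (f : dual) : linear f.
Proof. by case: f => f /= /asboolP[]. Qed.

HB.instance Definition _ (f : dual) :=
  GRing.isLinear.Build R Y R^o _ (dual_fun f) (dual_linear f).

Lemma dual_continuous (f : dual) : continuous f.
Proof. by case: f => f /= /asboolP[]. Qed.

Definition dual_norm (f : dual) : R := fine (opnorm f).

Lemma opnorm_dual_fin (f : dual) : opnorm f \is a fin_num.
Proof.
have /linear_boundedP := continuous_linear_bounded 0 (@dual_continuous f 0).
move=> /pinfty_ex_gt0[r r0 fr].
rewrite ge0_fin_numE; last first.
  by apply: ereal_sup_ubound; exists 0; rewrite /= ?normr0 ?ler01// linear0 normr0.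
apply: (@le_lt_trans _ _ r%:E); last exact: ltry.
apply: ge_ereal_sup => _ [x /= x1 <-]; rewrite lee_fin.
by rewrite (le_trans (fr x))// ler_piMr// ltW.
Qed.

Lemma dual_norm_ub (f : dual) x : `|x| <= 1 -> `|f x| <= dual_norm f.
Proof.
move=> x1; rewrite -lee_fin fineK ?opnorm_dual_fin//.
by apply: ereal_sup_ubound; exists x.
Qed.

Lemma dual_norm_le (f : dual) r :
  (forall x, `|x| <= 1 -> `|f x| <= r) -> dual_norm f <= r.
Proof.
move=> fr; rewrite -lee_fin fineK ?opnorm_dual_fin//.
by apply: ge_ereal_sup => _ [x /= x1 <-]; rewrite lee_fin fr.
Qed.

Lemma dual_norm_ge0 (f : dual) : 0 <= dual_norm f.
Proof. by apply: le_trans (@dual_norm_ub f 0 _) => //; rewrite normr0. Qed.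

Lemma dual_normD (f g : dual) : dual_norm (f + g) <= dual_norm f + dual_norm g.
Proof.
apply: dual_norm_le => x x1.
by rewrite (le_trans (ler_normD _ _))// lerD// dual_norm_ub.
Qed.

Lemma dual_normZ_le a (f : dual) : dual_norm (a *: f) <= `|a| * dual_norm f.
Proof.
apply: dual_norm_le => x x1.
by rewrite [X in `|X|](_ : _ = a * f x)// normrM ler_wpM2l// dual_norm_ub.
Qed.

Lemma dual_normZ a (f : dual) : dual_norm (a *: f) = `|a| * dual_norm f.
Proof.
apply/eqP; rewrite eq_le dual_normZ_le /=.
have [->|a0] := eqVneq a 0; first by rewrite normr0 mul0r dual_norm_ge0.
rewrite -ler_pdivlMl ?normr_gt0// -normfV.
by rewrite -{1}[f](scalerK a0) dual_normZ_le.
Qed.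

Lemma dual_norm0_eq0 (f : dual) : dual_norm f = 0 -> f = 0.
Proof.
move=> f0; apply/val_inj/funext => x /=.
have fx1 y : `|y| <= 1 -> f y = 0.
  by move=> /(dual_norm_ub f); rewrite f0 normr_le0 => /eqP.
have [->|x0] := eqVneq x 0; first by rewrite linear0.
have nx0 : `|x| != 0 by rewrite normr_eq0.
rewrite -[x](scalerKV nx0) linearZ/= fx1 ?scaler0//.
by rewrite normrZ normfV normr_id mulVf.
Qed.

HB.instance Definition _ := Lmodule_isNormed.Build R dual
  dual_normD dual_normZ dual_norm0_eq0.

End DualSpace.

Section Subspace.
Context {R : realType} {Y : normedModType R} (W : submodClosed Y).

(* The subspace [W] as a normed space in its own right, with the norm of [Y]. *)
Record subspace_of := SubspaceOf { sub_val :> Y ; _ : sub_val \in W }.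

HB.instance Definition _ := [isSub for sub_val].
HB.instance Definition _ := [Choice of subspace_of by <:].
HB.instance Definition _ := [SubChoice_isSubLmodule of subspace_of by <:].

Definition sub_norm (x : subspace_of) : R := `|sub_val x|.

Lemma sub_normD x y : sub_norm (x + y) <= sub_norm x + sub_norm y.
Proof. exact: ler_normD. Qed.

Lemma sub_normZ a x : sub_norm (a *: x) = `|a| * sub_norm x.
Proof. exact: normrZ. Qed.

Lemma sub_norm0_eq0 x : sub_norm x = 0 -> x = 0.
Proof. by move=> /normr0_eq0 x0; exact: val_inj. Qed.

HB.instance Definition _ := Lmodule_isNormed.Build R subspace_of
  sub_normD sub_normZ sub_norm0_eq0.

End Subspace.

Section EuclideanPlane.
Context (R : realType).

(* A fresh alias: the library's norm on ['rV_2] is the maximum norm. *)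
Definition ell2_plane : Type := 'rV[R]_2.

HB.instance Definition _ := GRing.Lmodule.on ell2_plane.

Definition ell2_norm (x : ell2_plane) : R :=
  Num.sqrt (\sum_(i < 2) (x ord0 i) ^+ 2).

Lemma ell2_normD x y : ell2_norm (x + y) <= ell2_norm x + ell2_norm y.
Proof.
rewrite /ell2_norm !big_ord_recl !big_ord0 !addr0 !mxE.
set a := x _ _; set b := x _ _; set c := y _ _; set d := y _ _.
have p0 : 0 <= a ^+ 2 + b ^+ 2 by rewrite addr_ge0 ?sqr_ge0.
have q0 : 0 <= c ^+ 2 + d ^+ 2 by rewrite addr_ge0 ?sqr_ge0.
set p := a ^+ 2 + b ^+ 2 in p0 *; set q := c ^+ 2 + d ^+ 2 in q0 *.
have sp0 := sqrtr_ge0 p; have sq0 := sqrtr_ge0 q.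
rewrite -[leRHS]ger0_norm ?addr_ge0// -sqrtr_sqr ler_wsqrtr//.
rewrite [leRHS]sqrrD !sqr_sqrtr//.
have H : a * c + b * d <= Num.sqrt p * Num.sqrt q.
  rewrite -sqrtrM// (le_trans (ler_norm _))// -sqrtr_sqr ler_wsqrtr//.
  rewrite -subr_ge0 (_ : _ - _ = (a * d - b * c) ^+ 2) ?sqr_ge0//.
  by rewrite /p /q; ring.
rewrite /p /q mulr2n; lra.
Qed.

Lemma ell2_normZ a x : ell2_norm (a *: x) = `|a| * ell2_norm x.
Proof.
rewrite /ell2_norm -sqrtr_sqr -sqrtrM ?sqr_ge0// mulr_sumr.
by congr Num.sqrt; apply: eq_bigr => i _; rewrite !mxE exprMn.
Qed.

Lemma ell2_norm0_eq0 x : ell2_norm x = 0 -> x = 0.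
Proof.
move=> /eqP; rewrite sqrtr_eq0 => le0.
have s0 : \sum_(i < 2) x ord0 i ^+ 2 == 0.
  by rewrite eq_le le0 sumr_ge0// => i _; exact: sqr_ge0.
move: s0; rewrite psumr_eq0 => [/allP s0|i _]; last exact: sqr_ge0.
apply/rowP => i; rewrite mxE; apply/eqP; rewrite -sqrf_eq0.
by apply: s0; rewrite mem_index_enum.
Qed.

HB.instance Definition _ := Lmodule_isNormed.Build R ell2_plane
  ell2_normD ell2_normZ ell2_norm0_eq0.

End EuclideanPlane.

Section Constants.
Context {R : realType}.

(* The infima and suprema below are taken in [\bar R], so that none of them
   presupposes boundedness.  In dimension at least 2 the index sets are
   nonempty, and 1 <= C_BM Y <= 2 and 0 <= C_AO Y <= 1. *)

(* [S] is the inverse of the linear isomorphism [T]. *)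
Definition BM_distance (X Z : normedModType R) : \bar R :=
  ereal_inf [set d | exists (T : {linear X -> Z}) (S : {linear Z -> X}),
    [/\ cancel T S, cancel S T & d = (opnorm T * opnorm S)%E]].

Definition C_BM (Y : normedModType R) : \bar R :=
  ereal_sup [set c | exists2 W : submodClosed Y, has_dim (subspace_of W) 2 &
    c = (BM_distance (subspace_of W) (ell2_plane R) ^+ 2)%E].

Definition duality_map (Y : normedModType R) (y : Y) : set (dual Y) :=
  [set ys : dual Y | ys y = `|y| ^+ 2 /\ `|y| ^+ 2 = `|ys| ^+ 2].

Definition ortho_pairs (Y : normedModType R) : set (Y * Y) :=
  [set p | exists2 zs : dual Y, duality_map p.2 zs & zs p.1 = 0].

Definition C_AO (Y : normedModType R) : \bar R :=
  ereal_sup [set r | exists (z0 z : Y) (z0s : dual Y),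
    [/\ z0 != 0, z != 0, ortho_pairs (z0, z), duality_map z0 z0s &
        r = (z0s z / (`|z| * `|z0|))%:E]].

Definition strictly_convex (Y : normedModType R) : Prop :=
  forall (y1 y2 : Y) (t : R), y1 <> y2 -> `|y1| = 1 -> `|y2| = 1 ->
    0 < t < 1 -> `|t *: y1 + (1 - t) *: y2| < 1.

Definition residual_minimizer (U V : normedModType R) (B : U -> dual V)
    (f : dual V) (Un : submodClosed U) (un : U) : Prop :=
  un \in Un /\ forall wn, wn \in Un -> `|f - B un| <= `|f - B wn|.

End Constants.

(* Main.v *)
From HB Require Import structures.
Require Import Defs.
From mathcomp Require Import all_boot all_order all_algebra.
From mathcomp Require Import all_classical all_reals all_analysis.
From mathcomp Require Import ring lra.

(* For a residual minimizer un, put g = B un and r = f - B un; then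
   |r| <= |r + t g| for all t, and everything in (ii) is a bound of |g| by |f|
   under this orthogonality.

   Banach-Mazur: transport a plane containing r and g to the Euclidean plane at
   the cost of a factor k = |T| |T^-1|.  There the hypothesis bounds the sine of
   the angle between T r and T g below by 1 / k, a condition symmetric in the two
   vectors; exchanging them and transporting back costs another factor k.

   Asymmetric orthogonality: if r and g attained their norms, at z and z0 say
   with g z = 0, then |g| = f z0 - r z0 and - r z0 <= C_AO |r|.  As V need not be
   reflexive, z and z0 only exist approximately.  A functional norming
   x = z - e z0 is almost dominated by r at z0, and if y is a point of smallest
   norm on the line z0 + R x, then (x, y) is an exactly orthogonal pair to which
   C_AO applies; let e tend to 0.

   Norming functionals come from a Hahn-Banach theorem, obtained from minimal
   sublinear functionals.  Existence in (i) is by induction on the dimension, one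
   line being added at a time. *)

Set Implicit Arguments.
Unset Strict Implicit.
Unset Printing Implicit Defensive.

Import Order.TTheory GRing.Theory Num.Theory.
Import numFieldNormedType.Exports.

Local Open Scope classical_set_scope.
Local Open Scope ring_scope.

(** * Sublinear functionals and the Hahn-Banach theorem *)

Definition sublinear {R : realType} {V : lmodType R} (p : V -> R) :=
  (forall u v, p (u + v) <= p u + p v) /\
  (forall t v, 0 <= t -> p (t *: v) <= t * p v).

Section Sublinear.
Context {R : realType} {V : lmodType R}.
Implicit Types p q : V -> R.

Lemma sublinear_geN p v : sublinear p -> - p (- v) <= p v.
Proof.
move=> [pD _].
have p0 : 0 <= p 0 by have := pD 0 0; rewrite addr0; lra.
by have := pD v (- v); rewrite subrr; lra.
Qed.

Lemma sublinearZ p t v : sublinear p -> 0 <= t -> p (t *: v) = t * p v.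
Proof.
move=> [pD pZ] t0; apply/eqP; rewrite eq_le pZ//=.
have [->|tn0] := eqVneq t 0.
  by have := pD 0 0; rewrite mul0r scale0r addr0; lra.
have {}t0 : 0 < t by rewrite lt_def tn0.
rewrite -ler_pdivlMl//.
by rewrite -{1}[v](scalerK tn0) pZ// invr_ge0 ltW.
Qed.

(** Used for chains in Zorn's lemma, for lowering along a ray, and for the distance to a line. The
    minorant [m] makes every infimum a genuine one. *)
Lemma sublinear_inf_image (I : Type) (A : set I) (F : I -> V -> R) (m : V -> R) :
  (forall i v, A i -> m v <= F i v) ->
  (forall i j u v, A i -> A j ->
    exists2 k, A k & F k (u + v) <= F i u + F j v) ->
  (forall i t v, A i -> 0 < t -> exists2 k, A k & F k (t *: v) <= t * F i v) ->
  (exists2 i, A i & F i 0 <= 0) ->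
  let q v := inf [set F i v | i in A] in
  sublinear q /\ (forall i v, A i -> q v <= F i v).
Proof.
move=> mF FD FZ [i0 Ai0 Fi0] q.
have qF i v : A i -> q v <= F i v.
  move=> Ai; apply: ge_inf; last by exists i.
  by exists (m v) => _ [j Aj <-]; exact: mF.
have qge v x : (forall i, A i -> x <= F i v) -> x <= q v.
  move=> xF; apply: lb_le_inf; first by exists (F i0 v), i0.
  by move=> _ [i Ai <-]; exact: xF.
split=> //; split.
  move=> u v; rewrite -lerBlDl; apply: (qge) => j Aj.
  rewrite lerBlDr -lerBlDl; apply: (qge) => i Ai.
  have [k Ak Fk] := FD i j u v Ai Aj.
  have := qF _ (u + v) Ak; lra.
move=> t v; rewrite le_eqVlt => /orP[/eqP <-|t0].
  by rewrite scale0r mul0r (le_trans (qF _ _ Ai0)).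
rewrite -ler_pdivrMl//; apply: (qge) => i Ai.
have [k Ak Fk] := FZ i t v Ai t0.
by rewrite ler_pdivrMl// (le_trans (qF _ _ Ak)).
Qed.

Lemma sublinear_minimal p : sublinear p ->
  exists q, [/\ sublinear q, forall v, q v <= p v &
    forall q', sublinear q' -> (forall v, q' v <= q v) -> q' = q].
Proof.
move=> sp.
pose T := {q : V -> R | sublinear q /\ forall v, q v <= p v}.
(* The order is reversed, so that a maximal element is a minimal functional. A nonempty chain has
   its pointwise infimum as a bound, kept finite by [- p (- v) <= - s (- v) <= s v]. *)
pose le (q q' : T) := `[< forall v, sval q' v <= sval q v >].
have [|||A tot|[q [sq qp]] maxq] := @Zorn T le.
- by move=> t; apply/asboolP.
- move=> r s t /asboolP rs /asboolP st; apply/asboolP => v.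
  exact: le_trans (st v) (rs v).
- move=> [s Ps] [t Pt] /asboolP/= st /asboolP/= ts; apply: eq_exist => /=.
  by apply/funext => v; apply/eqP; rewrite eq_le ts st.
- have [->|/set0P A0] := eqVneq A set0.
    by exists (exist _ p (conj sp (fun v => lexx _))).
  have := @sublinear_inf_image T A (fun s => sval s) (fun v => - p (- v)).
  case.
  + move=> [s [ss sp']] v _ /=; apply: le_trans (sublinear_geN v ss).
    by rewrite lerN2.
  + move=> s t u v As At; have [|] := tot s t As At => /asboolP st.
      exists t => //; have := st u; have := (proj1 (svalP t)).1 u v; lra.
    exists s => //; have := st v; have := (proj1 (svalP s)).1 u v; lra.
  + move=> s t v As t0; exists s => //.
    by apply: (proj1 (svalP s)).2; exact: ltW.
  + case: A0 => s As; exists s => //.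
    have := (proj1 (svalP s)).2 0 0 (lexx _).
    by rewrite scale0r mul0r.
  set q := (fun v => inf _) => sq qA.
  have qp v : q v <= p v.
    case: A0 => s As; exact: le_trans (qA s v As) (proj2 (svalP s) v).
  by exists (exist _ q (conj sq qp)) => s As; apply/asboolP => v; exact: qA.
exists q; split=> // q' sq' q'q.
have q'p v : q' v <= p v by exact: le_trans (qp v).
have := maxq (exist _ q' (conj sq' q'p)).
by move=> /(_ (asboolT q'q)) /(congr1 sval) /= ->.
Qed.

(** The largest sublinear minorant of a sublinear [q] whose value at [- x] is at most [- q x]. *)
Let shift q x v := inf [set q (v + t *: x) - t * q x | t in [set t | 0 <= t]].

Let shiftP q x : sublinear q ->
  [/\ sublinear (shift q x), forall v, shift q x v <= q v &
      shift q x (- x) <= - q x].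
Proof.
move=> sq; have [qD _] := sq.
have [||||sS S] := @sublinear_inf_image R [set t | 0 <= t]
    (fun t v => q (v + t *: x) - t * q x) (fun v => - q (- v)).
- move=> t v /= t0; have := qD (v + t *: x) (- v).
  by rewrite addrAC subrr add0r sublinearZ//; lra.
- move=> s t u v /= s0 t0; exists (s + t); first exact: addr_ge0.
  by have := qD (u + s *: x) (v + t *: x); rewrite addrACA -scalerDl; lra.
- move=> s t v /= s0 t0; exists (t * s); first by rewrite mulr_ge0// ltW.
  rewrite -scalerA -scalerDr sublinearZ ?(ltW t0)// mulrBr mulrA.
  exact: lexx.
- by exists 0; rewrite /= ?lexx// add0r sublinearZ ?lexx// subrr.
split=> //.
  by move=> v; have := S 0 v (lexx _); rewrite scale0r addr0 mul0r subr0.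
have := S 1 (- x) ler01; rewrite scale1r addNr mul1r.
by have := sublinearZ 0 sq (lexx 0); rewrite scale0r mul0r => ->; lra.
Qed.

(* Lowering a minimal sublinear [q] along the ray spanned by [x] changes
   nothing, which forces [q (- x) = - q x]. *)
Lemma sublinear_dominates_linear p : sublinear p ->
  exists L : V -> R^o, linear L /\ forall v, L v <= p v.
Proof.
move=> /sublinear_minimal[q [sq qp minq]]; exists q; split=> //.
have qN x : q (- x) = - q x.
  have [sS Sq SN] := shiftP x sq.
  move: SN; rewrite (minq _ sS Sq) => qN; apply/eqP; rewrite eq_le qN /=.
  have := sublinear_geN x sq; lra.
have qZ t x : q (t *: x) = t * q x.
  have [t0|t0] := leP 0 t; first exact: sublinearZ.
  rewrite -[t]opprK scaleNr qN sublinearZ ?mulNr// oppr_ge0; exact: ltW.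
move=> t u v; rewrite -[RHS]/(t * q u + q v) -qZ; apply/eqP.
rewrite eq_le (proj1 sq) /=.
have := proj1 sq (t *: u + v) (- v); rewrite addrK qN; lra.
Qed.

(** A linear functional below [shift p y] satisfies [L (- y) <= - p y], which is the missing
    inequality [p y <= L y]. *)
Lemma sublinear_supporting_linear p y : sublinear p ->
  exists L : V -> R^o, [/\ linear L, forall v, L v <= p v & L y = p y].
Proof.
move=> sp; have [sS Sp SN] := shiftP y sp.
have [L [lL LS]] := sublinear_dominates_linear sS.
exists L; split=> // [v|]; first exact: le_trans (Sp v).
apply/eqP; rewrite eq_le (le_trans (LS y))//=.
have L0 : L 0 = 0.
  by have := lL 1 0 0; rewrite scale1r addr0 scale1r; move: (L 0) => l; lra.
have := lL (-1) y 0; rewrite addr0 L0 addr0 scaleN1r scaleN1r => LN.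
have := LS (- y); rewrite LN => H.
by rewrite -lerN2 (le_trans H).
Qed.

End Sublinear.

(** For [|t| > M] the lower bound exceeds [|phi 0|], so the minimum over the compact interval
    [[- M, M]] is global. *)
Lemma coercive_minimizer {R : realType} (phi : R -> R) (a b : R) :
  continuous phi -> 0 < a -> (forall t, a * `|t| - b <= phi t) ->
  exists t0, forall t, phi t0 <= phi t.
Proof.
move=> cphi a0 lb; set M := (`|phi 0| + `|b|) / a.
have M0 : 0 <= M by rewrite divr_ge0 ?addr_ge0// ltW.
have [|c _ cmin] := @EVT_min R phi (- M) M _ (continuous_subspaceT cphi).
  by rewrite ge0_cp.
exists c => t; have [tM|tM] := boolP (t \in `[(- M), M]); first exact: cmin.
have c0 : phi c <= phi 0 by apply: cmin; rewrite in_itv /= oppr_le0 M0.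
apply: (le_trans c0); apply: le_trans (lb t).
have : M < `|t| by rewrite ltNge ler_norml; move: tM; rewrite in_itv.
rewrite /M ltr_pdivrMr// mulrC => Mt.
have := ler_norm (phi 0); have := ler_norm b; lra.
Qed.

Lemma dim_ge2_independent {R : realType} {Y : lmodType R} : dim_ge Y 2 ->
  exists x y : Y, forall a b : R, a *: x + b *: y = 0 -> a = 0 /\ b = 0.
Proof.
move=> [e ie]; exists (e ord0), (e (lift ord0 ord0)) => a b ab.
pose c (i : 'I_2) := if i == ord0 then a else b.
have c0 : forall i, c i = 0 by apply: ie; rewrite !big_ord_recl big_ord0 addr0.
by have := c0 ord0; have := c0 (lift ord0 ord0).
Qed.

(** * Norming functionals and orthogonal pairs *)

Section Dual.
Context {R : realType} {V : normedModType R}.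
Implicit Types (x y z : V) (l r g : dual V).

Lemma dualDE l m x : (l + m) x = l x + m x. Proof. by []. Qed.

Lemma dualZE (a : R) l x : (a *: l) x = a * l x. Proof. by []. Qed.

Lemma dual_addZ l (k : R) x y : l (x + k *: y) = l x + k * l y.
Proof. by rewrite addrC dual_linear addrC. Qed.

Lemma ler_dual l x : `|l x| <= `|l| * `|x|.
Proof.
have [->|x0] := eqVneq x 0; first by rewrite linear0 !normr0 mulr0.
have nx0 : `|x| != 0 by rewrite normr_eq0.
rewrite -{1}[x](scalerKV nx0) linearZ /= normrZ normr_id mulrC.
rewrite ler_wpM2r// dual_norm_ub//.
by rewrite normrZ normfV normr_id mulVf.
Qed.

Lemma ler_dual_ball l x : `|x| <= 1 -> `|l x| <= `|l|.
Proof. exact: dual_norm_ub. Qed.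

Lemma dual_norm_adherent l (e : R) : 0 < e ->
  exists2 x, `|x| <= 1 & `|l| - e <= l x.
Proof.
move=> e0; apply: contrapT => nx.
suff : `|l| <= `|l| - e by lra.
apply: dual_norm_le => x x1; rewrite ler_norml; apply/andP; split.
  rewrite lerNl -linearN leNgt; apply/negP => lx.
  by apply: nx; exists (- x); rewrite ?normrN// ltW.
by rewrite leNgt; apply/negP => lx; apply: nx; exists x => //; rewrite ltW.
Qed.

Lemma dominated_linear_dual (L : V -> R^o) :
  linear L -> (forall x, L x <= `|x|) ->
  exists2 l : dual V, `|l| <= 1 & forall x, l x = L x.
Proof.
move=> lL L1.
pose LL : {linear V -> R^o} := HB.pack L (GRing.isLinear.Build R V R^o _ L lL).
have Lx x : `|L x| <= `|x|.
  rewrite ler_norml L1 andbT lerNl -[L]/(LL : V -> R^o) -linearN.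
  by rewrite -normrN; exact: L1.
have cL : continuous LL.
  apply/linear_bounded_continuous/linear_boundedP.
  exists 1; split=> // M M1 x.
  by rewrite (le_trans (Lx x))// ler_peMl// ltW.
exists (Dual (asboolT (conj lL cL) : L \in @cont_linear R V)) => //.
by apply: dual_norm_le => x x1; rewrite (le_trans (Lx x)).
Qed.

(** The distance to the line [R x] is a seminorm that vanishes on the line and equals [|y|] at [y];
    a linear functional supporting it at [y] is the one sought. *)
Lemma ortho_functional x y : (forall k : R, `|y| <= `|y + k *: x|) ->
  exists l : dual V, [/\ `|l| <= 1, l y = `|y| & l x = 0].
Proof.
move=> yx; have := @sublinear_inf_image R V R setT
    (fun k v => `|v + k *: x|) (fun=> 0).
case.
- by move=> *; exact: normr_ge0.
- move=> s t u v _ _; exists (s + t) => //.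
  by rewrite scalerDl addrACA ler_normD.
- move=> s t v _ t0; exists (t * s) => //.
  by rewrite -scalerA -scalerDr normrZ (gtr0_norm t0).
- by exists 0 => //; rewrite scale0r addr0 normr0.
set p := (fun v => inf _) => sp pF.
have [L [lL Lp Ly]] := sublinear_supporting_linear y sp.
have [v|l l1 lE] := dominated_linear_dual lL.
  rewrite (le_trans (Lp v))// (le_trans (pF 0 v _))//.
  by rewrite scale0r addr0.
exists l; split => //.
  apply/eqP; rewrite eq_le; apply/andP; split.
    rewrite (le_trans (ler_norm _))// (le_trans (ler_dual _ _))//.
    by rewrite ler_piMl.
  rewrite lE Ly; apply: lb_le_inf; first by exists `|y + 0 *: x|, 0.
  by move=> _ [k _ <-].
have px (k : R) : l (k *: x) <= 0.
  rewrite lE (le_trans (Lp _))// (le_trans (pF (- k) _ _))//.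
  by rewrite scaleNr subrr normr0.
have := px 1; have := px (-1); rewrite !linearZ /= !scaleN1r scale1r oppr_le0.
by move=> ? ?; apply/eqP; rewrite eq_le; apply/andP.
Qed.

Lemma norming_functional x : exists2 l : dual V, `|l| <= 1 & l x = `|x|.
Proof.
have [k|l [l1 lx _]] := @ortho_functional 0 x; last by exists l.
by rewrite scaler0 addr0.
Qed.

Lemma scale_duality_map l x : `|l| <= 1 -> l x = `|x| ->
  duality_map x (`|x| *: l).
Proof.
move=> l1 lx; split; first by rewrite dualZE lx expr2.
have [->|x0] := eqVneq x 0; first by rewrite normr0 scale0r normr0.
rewrite normrZ normr_id.
suff -> : `|l| = 1 by rewrite mulr1.
apply/eqP; rewrite eq_le l1 /= -(ler_pM2r (x := `|x|)) ?normr_gt0//.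
by rewrite mul1r -{1}lx (le_trans (ler_norm _))// ler_dual.
Qed.

(** Here [x] plays [z0] and [y] plays [z]. Passing from [y] to [- y] keeps the orthogonality, which
    accounts for the absolute value. *)
Lemma ortho_pairs_ratio x y l : x != 0 -> y != 0 ->
  (forall k : R, `|y| <= `|y + k *: x|) -> `|l| <= 1 -> l x = `|x| ->
  ((`|l y| / `|y|)%:E <= C_AO V)%E.
Proof.
move=> x0 + + l1 lx; wlog ly0 : y / 0 <= l y => [H y0 yx|y0 yx].
  have [ly|ly] := leP 0 (l y); first exact: H.
  rewrite -[`|y|]normrN -[`|l y|]normrN -linearN.
  apply: H; rewrite ?linearN ?oppr_ge0 ?oppr_eq0 ?(ltW ly)// => k.
  rewrite normrN (le_trans (yx (- k)))//.
  by rewrite -[leRHS]normrN opprD opprK scaleNr.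
rewrite ger0_norm//; have [m [m1 my mx]] := ortho_functional yx.
apply: ereal_sup_ubound; exists x, y, (`|x| *: l); split=> //.
- exists (`|y| *: m); first exact: scale_duality_map.
  by rewrite dualZE mx mulr0.
- exact: scale_duality_map.
- congr EFin; rewrite dualZE; have : `|x| != 0 by rewrite normr_eq0.
  have : `|y| != 0 by rewrite normr_eq0.
  by move=> *; field; apply/andP.
Qed.

Lemma norm_line_minimizer x y : exists k : R, forall t : R,
  `|y + k *: x| <= `|y + k *: x + t *: x|.
Proof.
have [->|x0] := eqVneq x 0; first by exists 0 => t; rewrite !scaler0 !addr0.
have [||t|k kmin] :=
    @coercive_minimizer R (fun k => `|y + k *: x|) `|x| `|y|.
- move=> k; apply: cvg_norm; apply: cvgD; first exact: cvg_cst.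
  by apply: cvgZr_tmp; exact: cvg_id.
- by rewrite normr_gt0.
- have := ler_normB (y + t *: x) y.
  rewrite addrAC subrr add0r normrZ /=; move: (`|t|) => T; lra.
- by exists k => t; rewrite -addrA -scalerDl; exact: kmin.
Qed.

End Dual.

(** * The bound by the asymmetric-orthogonality constant *)

Section AsymmetricOrthogonality.
Context {R : realType} {V : normedModType R}.
Implicit Types (x y z : V) (l r g : dual V).

Lemma C_AO_ge0 : dim_ge V 2 -> (0 <= C_AO V)%E.
Proof.
move=> /dim_ge2_independent[x [y0 xy0]].
have x0 : x != 0.
  apply/eqP => x0; have [|/eqP] := xy0 1 0; last by rewrite oner_eq0.
  by rewrite x0 scaler0 scale0r addr0.
have [k kmin] := norm_line_minimizer x y0; set y := y0 + k *: x in kmin.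
have yn0 : y != 0.
  apply/eqP => y0E; have [|_ /eqP] := xy0 k 1; last by rewrite oner_eq0.
  by rewrite scale1r addrC.
have [l l1 lx] := norming_functional x.
apply: le_trans (ortho_pairs_ratio x0 yn0 kmin l1 lx).
by rewrite lee_fin divr_ge0.
Qed.

(* A Helly-type substitute for a norming element of the bidual annihilating
   [g], which need not come from [V]. *)
Lemma ortho_dual_almost_norming r g (e : R) :
  (forall t : R, `|r| <= `|r + t *: g|) -> 0 < e ->
  exists z, [/\ `|z| <= 1, `|r| - e <= r z & `|g z| <= e].
Proof.
(* [d] is so small that perturbing [r] by [d *: g], plus a tolerance [d ^+ 2], costs at most [e]. *)
move=> rg e0; pose d := Num.min 1 (e / (1 + `|g|)).
have G0 : 0 < 1 + `|g| by rewrite ltr_pwDl.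
have d0 : 0 < d by rewrite lt_min ltr01 divr_gt0.
have d1 : d <= 1 by rewrite ge_min lexx.
have de : d * (1 + `|g|) <= e by rewrite -ler_pdivlMr// ge_min lexx orbT.
have dg : 0 <= d * `|g| by rewrite mulr_ge0// ltW.
have dd : d ^+ 2 <= d by rewrite expr2 ler_piMr// ltW.
have d20 : 0 < d ^+ 2 by rewrite exprn_gt0.
clearbody d.
(* Almost norming [r + s *: g] means almost norming [r]; moreover [r z <= |r|] leaves
   [s * g z >= - d ^+ 2]. Dividing by [d] for both signs of [s] gives [g zp >= - d] and
   [g zn <= d]. *)
have near z s : `|z| <= 1 -> `|s| = d -> `|r| - d ^+ 2 <= (r + s *: g) z ->
    `|r| - e <= r z /\ - d ^+ 2 <= s * g z.
  move=> z1 sd; rewrite dualDE dualZE => H.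
  have : `|s * g z| <= d * `|g| by rewrite normrM sd ler_pM2l// ler_dual_ball.
  have := ler_dual_ball r z1.
  rewrite !ler_norml => /andP[_ rz] /andP[_ sg]; split; last lra.
  lra.
have [zp zp1 rp] := dual_norm_adherent (r + d *: g) d20.
have [zn zn1 rn] := dual_norm_adherent (r + (- d) *: g) d20.
have [||rzp gzp] := near zp d zp1; first by rewrite gtr0_norm.
  by apply: le_trans rp; rewrite lerB.
have [||rzn gzn] := near zn (- d) zn1; first by rewrite normrN gtr0_norm.
  by apply: le_trans rn; rewrite lerB.
have {}gzp : - d <= g zp by rewrite -(ler_pM2l d0) mulrN -expr2.
have {}gzn : g zn <= d by rewrite -(ler_pM2l d0) -expr2 -lerN2 -(mulNr d (g zn)).
have {}de : d <= e.
  by apply: le_trans de; rewrite mulrDr mulr1 lerDl.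
clear near rp rn dg dd d20 d1 rg.
have [gp|gp] := leP (g zp) e.
  by exists zp; split=> //; rewrite ler_norml gp andbT; lra.
have [gn|gn] := leP (- e) (g zn).
  by exists zn; split=> //; rewrite ler_norml gn; lra.
(* In the remaining case [g] has opposite signs at [zn] and [zp], and a convex combination of the
   two annihilates it. *)
have D0 : 0 < g zp - g zn by lra.
have [t /andP[t0 t1] gt0] : exists2 t, 0 <= t <= 1 & g zn + t * (g zp - g zn) = 0.
  exists (- g zn / (g zp - g zn)); last by field; lra.
  by rewrite divr_ge0 ?ler_pdivrMr ?mul1r//; lra.
have s0 : 0 <= 1 - t by rewrite subr_ge0.
have zE l : l ((1 - t) *: zn + t *: zp) = l zn + t * (l zp - l zn).
  by rewrite dual_addZ linearZ /= -[_ *: _]/((1 - t) * l zn); ring.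
exists ((1 - t) *: zn + t *: zp); split.
- rewrite (le_trans (ler_normD _ _))// !normrZ (ger0_norm t0) (ger0_norm s0).
  rewrite -[leRHS](subrK t); apply: lerD; exact: ler_piMr.
- rewrite zE.
  have -> : r zn + t * (r zp - r zn) = (1 - t) * r zn + t * r zp by ring.
  rewrite -[leLHS]mul1r -{1}(subrK t 1) mulrDl.
  by apply: lerD; exact: ler_wpM2l.
- by rewrite zE gt0 normr0 ltW.
Qed.

(** Up to errors of order [e], [|g| <= g y = (r + g) y - r y <= |r + g| - |r| * l y], where [l]
    norms [x]. Since [(x, y)] is an orthogonal pair, [- l y <= c * |y| <= c], and
    [|r| <= |r + g|]. *)
Lemma C_AO_projection_bound (c : R) r g : C_AO V = c%:E -> 0 <= c ->
  (forall t : R, `|r| <= `|r + t *: g|) -> `|g| <= (1 + c) * `|r + g|.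
Proof.
move=> Vc c0 rg.
have rf : `|r| <= `|r + g| by have := rg 1; rewrite scale1r.
have [r0|r0] := eqVneq r 0; first by rewrite r0 add0r ler_peMl// lerDl.
have {}r0 : 0 < `|r| by rewrite normr_gt0.
set p := `|r| in r0 rf *; set G := `|g|; set F := `|r + g| in rf *.
have G0 : 0 <= G by exact: normr_ge0.
have F0 : 0 <= F by exact: normr_ge0.
(* [K] adds up the error coefficients [5 + 8 p] of [ry] and [5 + 4 G] of [gy] below. *)
apply/ler_addgt0Pr => d d0; pose K := 10 + 8 * p + 4 * G.
have K0 : 0 < K by rewrite /K; lra.
pose e := Num.min (1 / 4) (Num.min (p / 4) (d / K)).
have e0 : 0 < e by rewrite !lt_min !divr_gt0// ltr01.
have e4 : e <= 1 / 4 by rewrite ge_min lexx.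
have ep : e <= p / 4 by rewrite !ge_min lexx orbT.
have eK : e * K <= d by rewrite -ler_pdivlMr// !ge_min lexx !orbT.
clearbody e.
have ee : e ^+ 2 <= e / 4 by rewrite expr2 ler_wpM2l ?(ltW e0)//; lra.
have e20 : 0 < e ^+ 2 by rewrite exprn_gt0.
(* The tolerance is [e ^+ 2] because the estimate of [l z0] divides it by [e]. *)
have [z [z1 rz gz]] := ortho_dual_almost_norming rg e20.
have [z0 z01 gz0] := dual_norm_adherent g e0.
rewrite -/p in rz; rewrite -/G in gz0.
pose x := z + (- e) *: z0.
have [l l1 lx] := norming_functional x.
have [k kmin] := norm_line_minimizer x z0; set y := z0 + k *: x in kmin.
have rx_le : r x <= p * `|x|.
  exact: le_trans (ler_norm _) (ler_dual _ _).
have rxE : r x = r z - e * r z0 by rewrite dual_addZ mulNr.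
have rz0 : - p <= r z0 <= p by rewrite -ler_norml ler_dual_ball.
have gz0_le : - G <= g z0 <= G by rewrite -ler_norml ler_dual_ball.
have /andP[rz0l rz0u] := rz0; have /andP[gz0l gz0u] := gz0_le.
have erz0 : e * r z0 <= e * p by rewrite ler_pM2l.
have xub : `|x| <= 1 + e.
  rewrite (le_trans (ler_normD _ _))// lerD// normrZ normrN gtr0_norm//.
  by rewrite ler_piMr// ltW.
have xlb : 1 / 2 <= `|x|.
  rewrite -(ler_pM2l r0) (le_trans _ rx_le)// rxE -/p.
  have : p * e <= p * (1 / 4) by rewrite ler_pM2l.
  lra.
(* [l] almost minimises along [z0], since [x] is [z] moved by [- e z0] *)
have lz0 : p * l z0 <= r z0 + e.
  have lxE : `|x| = l z - e * l z0 by rewrite -lx dual_addZ mulNr.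
  have lz : p * l z <= p.
    rewrite ler_piMr ?(ltW r0)// (le_trans (ler_norm _))//.
    by rewrite (le_trans (ler_dual_ball _ z1)).
  rewrite -(ler_pM2l e0) mulrDr -expr2.
  move: rx_le; rewrite lxE rxE => H.
  have -> : e * (p * l z0) = p * l z - p * (l z - e * l z0) by ring.
  lra.
have yub : `|y| <= 1.
  by have := kmin (- k); rewrite scaleNr addrK => /le_trans; exact.
have k4 : `|k| <= 4.
  have : `|k| * `|x| <= 2.
    have -> : `|k| * `|x| = `|y - z0| by rewrite /y addrAC subrr add0r normrZ.
    by rewrite (le_trans (ler_normB _ _))//; lra.
  have : `|k| * (1 / 2) <= `|k| * `|x| by rewrite ler_wpM2l.
  lra.
have kM (a b : R) : `|a| <= b -> - (4 * b) <= k * a.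
  move=> ab; have : `|k * a| <= 4 * b by rewrite normrM ler_pM.
  by rewrite ler_norml => /andP[].
(* The first term is at least [- e] by [lz0]; in the second, [|k| <= 4] and [r] almost attains
   [p * |x|] at [x]. *)
have ryE : r y - p * l y = (r z0 - p * l z0) + k * (r x - p * `|x|).
  by rewrite !(dual_addZ _ k z0 x) -lx; ring.
have ry : p * l y - 5 * e - 8 * p * e <= r y.
  have := kM (r x - p * `|x|) (e + 2 * p * e).
  rewrite ler_norml => /(_ _)/wrap[].
    rewrite rxE; apply/andP; split; last first.
      by rewrite -rxE; have := mulr_ge0 (ltW r0) (ltW e0); lra.
    have : p * `|x| <= p * (1 + e) by rewrite ler_pM2l.
    lra.
  lra.
have gy : G - 5 * e - 4 * G * e <= g y.
  have -> : g y = g z0 + k * g x by rewrite (dual_addZ _ k z0 x).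
  have := kM (g x) (e + G * e).
  have -> : g x = g z - e * g z0 by rewrite dual_addZ mulNr.
  move=> /(_ _)/wrap[]; last lra.
  rewrite (le_trans (ler_normB _ _))// lerD//; first lra.
  by rewrite normrM (gtr0_norm e0) mulrC ler_pM2r// ler_dual_ball.
have dK : e * (10 + 8 * p + 4 * G) <= d by [].
have cF0 : 0 <= c * F by rewrite mulr_ge0.
(* If [y = 0] there is no pair for [C_AO], but [gy] already bounds [G] by the error. *)
have [y0|y0] := eqVneq y 0.
  move: gy; rewrite y0 linear0 => gy.
  have := mulr_ge0 (ltW r0) (ltW e0); lra.
have fy : r y + g y <= F.
  by rewrite -dualDE (le_trans (ler_norm _))// ler_dual_ball.
have ly : - (c * F) <= p * l y.
  have xn0 : x != 0 by rewrite -normr_gt0; lra.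
  have := ortho_pairs_ratio xn0 y0 kmin l1 lx.
  rewrite Vc lee_fin ler_pdivrMr ?normr_gt0// => lc.
  have {}lc : - l y <= c * `|y|.
    by rewrite (le_trans _ lc)// -normrN ler_norm.
  rewrite -lerN2 opprK -mulrN (le_trans (ler_wpM2l (ltW r0) lc))//.
  rewrite mulrCA ler_wpM2l//.
  by rewrite (le_trans _ rf)// ler_piMr// ltW.
lra.
Qed.

End AsymmetricOrthogonality.

(** The value [-oo] is excluded by [C_AO_ge0]; for [+oo] the right-hand side is infinite because
    [r + g] is nonzero. *)
Lemma C_AO_projection_boundE {R : realType} {V : normedModType R}
  (r g : dual V) : dim_ge V 2 -> r + g != 0 ->
  (forall t : R, `|r| <= `|r + t *: g|) ->
  (`|g|%:E <= (1 + C_AO V) * `|r + g|%:E)%E.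
Proof.
move=> V2 f0 rg; move: (C_AO_ge0 V2) (fun c => @C_AO_projection_bound R V c r g).
case: (C_AO V) => [c||//].
  by rewrite lee_fin => c0 H; rewrite lee_fin (H c).
by move=> _ _; rewrite addey// gt0_mulye ?leey// lte_fin normr_gt0.
Qed.

(** * The Euclidean plane and the Banach-Mazur distance *)

Section BanachMazur.
Context {R : realType}.

(* With [A = |u|^2], [D = <u, v>] and [N = |v|^2], the hypothesis at
   [t = - D / N] says that the sine of the angle between [u] and [v] is at least
   [1 / k]; the conclusion is the same fact with [u] and [v] exchanged. *)
Lemma quasi_orthogonal_sym (A D N k : R) : 0 <= A -> 0 <= N -> 1 <= k ->
  (A = 0 -> D = 0) -> (forall t, A <= k * (A + 2 * t * D + t ^+ 2 * N)) ->
  0 <= A + 2 * D + N ->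
  N <= k * (A + 2 * D + N).
Proof.
move=> A0 N0 k1 AD H P0.
have k0 : 0 <= k by lra.
have [N00|Nn0] := eqVneq N 0; first by rewrite {1}N00 mulr_ge0.
have [A00|An0] := eqVneq A 0.
  by rewrite A00 AD// mulr0 !add0r ler_peMl.
have {}N0 : 0 < N by rewrite lt_def Nn0.
have {}A0 : 0 < A by rewrite lt_def An0.
have := H (- (D / N)); rewrite -(ler_pM2l N0).
have -> : N * (k * (A + 2 * (- (D / N)) * D + (- (D / N)) ^+ 2 * N)) =
  k * (A * N - D ^+ 2) by field; rewrite gt_eqF.
(* Completing the square isolates the Gram determinant [A * N - D ^+ 2], which [AN] bounds below. *)
move=> AN; rewrite -(ler_pM2l A0).
have -> : A * (k * (A + 2 * D + N)) = k * (A + D) ^+ 2 + k * (A * N - D ^+ 2).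
  by ring.
have : 0 <= k * (A + D) ^+ 2 by rewrite mulr_ge0// sqr_ge0.
lra.
Qed.

Let dot (u v : ell2_plane R) : R := \sum_(i < 2) u ord0 i * v ord0 i.

Lemma sqr_ell2_norm (u : ell2_plane R) : `|u| ^+ 2 = dot u u.
Proof.
rewrite -[`|u|]/(ell2_norm u) sqr_sqrtr; last first.
  by apply: sumr_ge0 => i _; exact: sqr_ge0.
by apply: eq_bigr => i _; rewrite expr2.
Qed.

Lemma sqr_ell2_normDZ (t : R) (u v : ell2_plane R) :
  `|u + t *: v| ^+ 2 = `|u| ^+ 2 + 2 * t * dot u v + t ^+ 2 * `|v| ^+ 2.
Proof.
by rewrite !sqr_ell2_norm /dot !big_ord_recl !big_ord0 !mxE; ring.
Qed.

Lemma ell2_quasi_orthogonal_sym (k : R) (u v : ell2_plane R) : 1 <= k ->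
  (forall t : R, `|u| <= k * `|u + t *: v|) -> `|v| <= k * `|u + v|.
Proof.
move=> k1 H; have k0 : 0 <= k by lra.
rewrite -ler_sqr ?nnegrE ?mulr_ge0// exprMn -[X in u + X]scale1r.
have uv1 := sqr_ell2_normDZ 1 u v.
rewrite mulr1 expr1n mul1r in uv1.
rewrite uv1; apply: quasi_orthogonal_sym; rewrite ?sqr_ge0 ?exprn_ege1//.
- move=> /eqP; rewrite sqrf_eq0 normr_eq0 => /eqP ->.
  by rewrite /dot big1// => i _; rewrite mxE mul0r.
- move=> t; rewrite -sqr_ell2_normDZ -exprMn ler_sqr ?nnegrE ?mulr_ge0//.
- by rewrite -uv1 sqr_ge0.
Qed.

Lemma opnorm_ratio (X Z : normedModType R) (T : {linear X -> Z}) x : x != 0 ->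
  ((`|T x| / `|x|)%:E <= opnorm T)%E.
Proof.
move=> x0; have nx0 : `|x| != 0 by rewrite normr_eq0.
apply: ereal_sup_ubound; exists (`|x|^-1 *: x) => /=.
  by rewrite normrZ normfV normr_id mulVf.
by rewrite linearZ normrZ normfV normr_id mulrC.
Qed.

(** With [k = |T| |S|], the two transports give [|g| <= k ^+ 2 * |r + g|], hence the square root.
    Positivity of both norms makes the product [+oo] when one of them is infinite. *)
Lemma BM_distance_ge (X : normedModType R) (r g : X) : r + g != 0 ->
  (forall t : R, `|r| <= `|r + t *: g|) ->
  ((Num.sqrt (`|g| / `|r + g|))%:E <= BM_distance X (ell2_plane R))%E.
Proof.
move=> f0 rg; apply: le_ereal_inf_tmp => _ [T [S [TK SK ->]]].
have Tf0 : T (r + g) != 0.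
  by apply: contra f0 => /eqP Tf; rewrite -(TK (r + g)) Tf linear0.
have nf0 : 0 < `|r + g| by rewrite normr_gt0.
have T0 : (0 < opnorm T)%E.
  by apply: lt_le_trans (opnorm_ratio T f0); rewrite lte_fin divr_gt0 ?normr_gt0.
have S0 : (0 < opnorm S)%E.
  apply: lt_le_trans (opnorm_ratio S Tf0).
  by rewrite lte_fin TK divr_gt0 ?normr_gt0.
move: T0 S0 (@opnorm_ratio X (ell2_plane R) T) (@opnorm_ratio (ell2_plane R) X S).
case: (opnorm T) => [a||//]; last by move=> _ S0 _ _; rewrite gt0_mulye// leey.
case: (opnorm S) => [b||//]; last by move=> T0 _ _ _; rewrite gt0_muley// leey.
rewrite !lte_fin => a0 b0 Ta Sb; rewrite lee_fin.
have {}Ta x : `|T x| <= a * `|x|.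
  have [->|x0] := eqVneq x 0; first by rewrite linear0 !normr0 mulr0.
  by have := Ta x x0; rewrite lee_fin ler_pdivrMr ?normr_gt0.
have {}Sb x : `|S x| <= b * `|x|.
  have [->|x0] := eqVneq x 0; first by rewrite linear0 !normr0 mulr0.
  by have := Sb x x0; rewrite lee_fin ler_pdivrMr ?normr_gt0.
have STb x : `|x| <= b * `|T x| by rewrite -{1}(TK x); exact: Sb.
have ab0 : 0 < a * b by exact: mulr_gt0.
have ab1 : 1 <= a * b.
  rewrite -(ler_pM2r nf0) mul1r (le_trans (STb _))// (mulrC a) -mulrA.
  by rewrite ler_pM2l.
(* [T r] and [T g] are orthogonal up to the factor [a * b]: [|T r| <= a * |r| <= a * |r + t *: g| <=
   a * b * |T r + t *: T g|]. *)
have vu : `|T g| <= a * b * `|T r + T g|.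
  apply: ell2_quasi_orthogonal_sym => // t.
  rewrite (le_trans (Ta r))// -mulrA ler_pM2l// (le_trans (rg t))//.
  by rewrite (le_trans (STb _))// linearD linearZ.
rewrite -(ger0_norm (ltW ab0)) -sqrtr_sqr ler_wsqrtr// ler_pdivrMr//.
rewrite (le_trans (STb g))// expr2 (mulrC a) -!mulrA ler_pM2l//.
apply: (le_trans vu); rewrite -!mulrA ler_pM2l// ler_pM2l//.
by rewrite -linearD.
Qed.

End BanachMazur.

(** * Planes in the dual and the bound by the Banach-Mazur constant *)

Section Plane.
Context {R : realType} {Y : normedModType R} (e0 e1 : Y).

Definition plane : {pred Y} :=
  fun y => `[< exists a b : R, y = a *: e0 + b *: e1 >].

Lemma plane_submod : submod_closed plane.
Proof.
split; first by apply/asboolP; exists 0, 0; rewrite !scale0r addr0.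
move=> t _ _ /asboolP[a [b ->]] /asboolP[c [d ->]]; apply/asboolP.
exists (t * a + c), (t * b + d).
by rewrite scalerDr !scalerA !scalerDl addrACA.
Qed.

HB.instance Definition _ := GRing.isSubmodClosed.Build R Y plane plane_submod.

Lemma mem_plane a b : a *: e0 + b *: e1 \in plane.
Proof. by apply/asboolP; exists a, b. Qed.

Lemma plane_dim :
  (forall a b : R, a *: e0 + b *: e1 = 0 -> a = 0 /\ b = 0) ->
  has_dim (subspace_of plane) 2.
Proof.
move=> ind.
have m0 : e0 \in plane by have := mem_plane 1 0; rewrite scale1r scale0r addr0.
have m1 : e1 \in plane by have := mem_plane 0 1; rewrite scale1r scale0r add0r.
exists (fun i : 'I_2 => if i == ord0 then SubspaceOf m0 else SubspaceOf m1).
split.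
  move=> c; rewrite !big_ord_recl big_ord0 /= addr0 => /(congr1 (@sub_val _ _ _)).
  move=> /ind[c0 c1] i; have [->//|i0] := eqVneq i ord0.
  by rewrite -c1; congr c; apply/val_inj; case: i i0 => -[|[|]].
move=> [y yW]; have /asboolP[a [b yE]] := yW.
exists (fun i : 'I_2 => if i == ord0 then a else b).
by apply/val_inj; rewrite !big_ord_recl big_ord0 /= addr0 /=.
Qed.

Lemma C_BM_plane_bound (r g : Y) :
  (forall a b : R, a *: e0 + b *: e1 = 0 -> a = 0 /\ b = 0) ->
  r \in plane -> g \in plane -> r + g != 0 ->
  (forall t : R, `|r| <= `|r + t *: g|) ->
  (`|g|%:E <= C_BM Y * `|r + g|%:E)%E.
Proof.
move=> ind rW gW f0 rg.
have nf0 : 0 < `|r + g| by rewrite normr_gt0.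
have := @BM_distance_ge R (subspace_of plane) (SubspaceOf rW) (SubspaceOf gW).
move=> /(_ _ rg)/wrap[].
  by apply: contra f0 => /eqP/(congr1 (@sub_val _ _ _)) /= ->.
rewrite -[`|SubspaceOf gW|]/(`|g|) -[`|_ + _|]/(`|r + g|) => sBM.
have -> : `|g|%:E = ((`|g| / `|r + g|)%:E * `|r + g|%:E)%E.
  by rewrite -EFinM divfK// gt_eqF.
rewrite lee_wpmul2r ?lee_fin//.
apply: (@le_trans _ _ (BM_distance (subspace_of plane) (ell2_plane R) ^+ 2)%E).
  rewrite -[_ / _]sqr_sqrtr ?divr_ge0// EFin_expe.
  rewrite !expe2; apply: lee_pmul => //; rewrite lee_fin; exact: sqrtr_ge0.
by apply: ereal_sup_ubound; exists (plane : submodClosed Y) => //; exact: plane_dim.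
Qed.

End Plane.

(** A functional norming a nonzero [x] in the kernel of [f] is independent of [f]; such an [x]
    exists in the span of two independent vectors. *)
Lemma dual_independent {R : realType} {V : normedModType R} (f : dual V) :
  dim_ge V 2 -> f != 0 ->
  exists h : dual V, forall a b : R, a *: f + b *: h = 0 -> a = 0 /\ b = 0.
Proof.
move=> /dim_ge2_independent[x0 [x1 xind]] f0.
have [x xn0 fx0] : exists2 x, x != 0 & f x = 0.
  have [fx1|fx1] := eqVneq (f x1) 0.
    exists x1 => //; apply/eqP => x10; have [|_ /eqP] := xind 0 1.
      by rewrite x10 scaler0 scale0r addr0.
    by rewrite oner_eq0.
  exists (f x1 *: x0 + (- f x0) *: x1).
    by apply/eqP => /xind[/eqP]; rewrite (negPf fx1).
  by rewrite dual_addZ linearZ /= -[_ *: _]/(f x1 * f x0); ring.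
have [l _ lx] := norming_functional x.
exists l => a b ab.
have b0 : b = 0.
  have /eqP := congr1 (fun m : dual V => m x) ab.
  rewrite dualDE !dualZE fx0 lx mulr0 add0r mulf_eq0 normr_eq0 (negPf xn0) orbF.
  by move=> /eqP.
split=> //; move: ab; rewrite b0 scale0r addr0 => /eqP.
by rewrite scaler_eq0 (negPf f0) orbF => /eqP.
Qed.

(** The plane is spanned by [f] and [g], or by [f] and an independent [h] when [g] is a multiple of
    [f]; it contains [r = f - g]. *)
Lemma C_BM_projection_bound {R : realType} {V : normedModType R}
  (r g : dual V) : dim_ge V 2 -> r + g != 0 ->
  (forall t : R, `|r| <= `|r + t *: g|) ->
  (`|g|%:E <= C_BM (dual V) * `|r + g|%:E)%E.
Proof.
move=> V2 f0 rg; set f := r + g in f0.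
have [h fh gh] : exists2 h : dual V,
    forall a b : R, a *: f + b *: h = 0 -> a = 0 /\ b = 0 & g \in plane f h.
  have [[a ga]|ng] := pselect (exists a : R, g = a *: f).
    have [h fh] := dual_independent V2 f0; exists h => //.
    by rewrite ga -[_ *: _]addr0 -(scale0r h); exact: mem_plane.
  exists g; last first.
    by have := mem_plane f g 0 1; rewrite scale0r scale1r add0r.
  move=> a b ab; have b0 : b = 0.
    apply/eqP; apply: contra_notT ng => b0; exists (- (b^-1 * a)).
    rewrite scaleNr -scalerA; apply/eqP; rewrite -addr_eq0 addrC.
    by rewrite -(scalerK b0 g) -scalerDr ab scaler0.
  split=> //; move: ab; rewrite b0 scale0r addr0 => /eqP.
  by rewrite scaler_eq0 (negPf f0) orbF => /eqP.
apply: (C_BM_plane_bound fh) => //.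
have rE : r = f - g by rewrite addrK.
have /asboolP[a [b gE]] := gh; rewrite rE; clearbody f.
apply/asboolP; exists (1 - a), (- b).
by rewrite gE opprD scalerBl scale1r scaleNr addrA.
Qed.

(** * Best approximation from finite-dimensional subspaces *)

Section Proximinal.
Context {R : realType} {Y : normedModType R}.

Definition proximinal (S : set Y) := forall y, exists s, S s /\
  forall s', S s' -> `|y - s| <= `|y - s'|.

(** If [d e = 0], then [e] lies in [S]. Otherwise [d (y - t *: e)], with [d] the distance to [S], is
    Lipschitz and coercive in [t]; a minimizing [t] is completed by a nearest point of [S]. *)
Lemma proximinal_add_line (S : set Y) (e : Y) :
  (forall (t : R) u v, S u -> S v -> S (t *: u + v)) -> proximinal S ->
  proximinal [set u | exists s (t : R), S s /\ u = s + t *: e].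
Proof.
move=> linS /choice[p pP]; pose d y := `|y - p y|.
have dle y s : S s -> d y <= `|y - s| by exact: (proj2 (pP y)).
have dlip u v : d u <= `|u - v| + d v.
  apply: le_trans (dle u (p v) (proj1 (pP v))) _.
  by rewrite -[u - p v](subrKA v) ler_normD.
move=> y; have [de0|de0] := eqVneq (d e) 0.
  have eS : S e.
    move/normr0_eq0/subr0_eq : de0 => eE; rewrite eE; exact: (proj1 (pP e)).
  exists (p y); split.
    by exists (p y), 0; rewrite scale0r addr0; split=> //; exact: (proj1 (pP y)).
  move=> _ [s [t [Ss ->]]]; apply: dle; rewrite addrC; exact: linS.
have {}de0 : 0 < d e by rewrite lt_def de0 normr_ge0.
have [||t|t0 t0min] := @coercive_minimizer R (fun t => d (y - t *: e)) (d e) (d y).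
- move=> t; apply/cvgrPdist_le => eps eps0.
  have K0 : 0 < `|e| + 1 by rewrite ltr_pwDr.
  have lip (a b : R) : d (y - a *: e) <= `|a - b| * `|e| + d (y - b *: e).
    apply: le_trans (dlip _ (y - b *: e)) _.
    rewrite (_ : y - a *: e - (y - b *: e) = (b - a) *: e).
      by rewrite normrZ distrC.
    by rewrite opprB addrC addrA subrK scalerBl.
  near=> s.
  have : `|t - s| * `|e| <= eps.
    apply: (@le_trans _ _ (`|t - s| * (`|e| + 1))).
      by rewrite ler_wpM2l// lerDl.
    rewrite -ler_pdivlMr//; near: s.
    by apply: cvgr_dist_le; [exact: cvg_id|rewrite divr_gt0].
  have := lip t s; have := lip s t; rewrite (distrC s).
  by rewrite ler_distlC; lra.
- exact: de0.
- have [->|tn0] := eqVneq t 0.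
    rewrite normr0 mulr0 scale0r subr0 sub0r /=.
    by apply: (@le_trans _ _ 0); rewrite ?oppr_le0 normr_ge0.
  set q := y - t *: e.
  rewrite lerBlDr mulrC -ler_pdivlMl ?normr_gt0//.
  (* This competitor for [e] yields [|t| * d e <= d y + d q]. *)
  have Sq : S (t^-1 *: (p y - p q)).
    have S0 : S 0.
      by have := linS (-1) _ _ (proj1 (pP y)) (proj1 (pP y)); rewrite scaleN1r addNr.
    rewrite -[_ *: _]addr0; apply: (linS) => //.
    by rewrite addrC -scaleN1r; apply: (linS); [exact: (proj1 (pP q))|exact: (proj1 (pP y))].
  apply: le_trans (dle _ _ Sq) _.
  have -> : e - t^-1 *: (p y - p q) = t^-1 *: ((y - p y) - (q - p q)).
    rewrite -{1}(scalerK tn0 e) -scalerBr; congr (_ *: _).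
    have -> : t *: e = y - q by rewrite /q opprB addrC subrK.
    by rewrite !opprB addrACA [RHS]addrACA; congr (_ + _); rewrite addrC.
  rewrite normrZ normfV ler_wpM2l ?invr_ge0//= (addrC (d _)).
  exact: ler_normB.
- exists (p (y - t0 *: e) + t0 *: e); split.
    by exists (p (y - t0 *: e)), t0; split=> //; exact: (proj1 (pP _)).
  move=> _ [s [t [Ss ->]]]; rewrite ![_ + _ *: e]addrC !opprD !addrA.
  exact: le_trans (t0min t) (dle _ _ Ss).
Unshelve. all: by end_near. Qed.

Lemma proximinal_span n (e : 'I_n -> Y) :
  proximinal [set u | exists c : 'I_n -> R, u = \sum_(i < n) c i *: e i].
Proof.
elim: n e => [|n IH] e y.
  exists 0; split; first by exists (fun=> 0); rewrite big_ord0.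
  by move=> _ [c ->]; rewrite big_ord0.
have [|s [[u [t [[c ->] ->]]] smin]] :=
    proximinal_add_line (e ord0) _ (IH (fun i => e (lift ord0 i))) y.
  move=> t _ _ [a ->] [b ->]; exists (fun i => t * a i + b i).
  rewrite scaler_sumr -big_split; apply: eq_bigr => i _.
  by rewrite scalerA scalerDl.
exists (\sum_(i < n) c i *: e (lift ord0 i) + t *: e ord0); split.
  exists (fun i => if unlift ord0 i is Some j then c j else t).
  rewrite big_ord_recl unlift_none addrC; congr (_ + _).
  by apply: eq_bigr => i _; rewrite liftK.
move=> _ [a ->]; apply: smin.
exists (\sum_(i < n) a (lift ord0 i) *: e (lift ord0 i)), (a ord0).
by split; [exists (fun i => a (lift ord0 i))|rewrite big_ord_recl addrC].
Qed.

End Proximinal.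

(** * Residual minimizers: existence, orthogonality, uniqueness *)

Section ResidualMinimization.
Context {R : realType} {U V : normedModType R} (B : {linear U -> dual V}).
Context (f : dual V) (Un : submodClosed U).

Lemma residual_minimizer_exists : finite_dim (subspace_of Un) ->
  exists un, residual_minimizer B f Un un.
Proof.
move=> [n [e [_ spe]]].
have [s [[c ->] cmin]] := proximinal_span (fun i => B (sub_val (e i))) f.
have BE (a : 'I_n -> R) : \sum_(i < n) a i *: B (sub_val (e i)) =
    B (\sum_(i < n) a i *: sub_val (e i)).
  by rewrite linear_sum; apply: eq_bigr => i _; rewrite linearZ.
exists (\sum_(i < n) c i *: sub_val (e i)); split.
  by apply: rpred_sum => i _; apply: rpredZ; case: (e i).
move=> w wU; have [a aE] := spe (SubspaceOf wU).
rewrite -BE; apply: cmin; exists a; rewrite BE; congr (B _).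
have := congr1 (@sub_val _ _ _) aE; rewrite /= => ->.
by rewrite (big_morph (@sub_val R U Un) (id1 := 0) (op1 := +%R)).
Qed.

(** Compare with the competitor [(1 - t) *: un]. *)
Lemma residual_minimizer_ortho un (t : R) : residual_minimizer B f Un un ->
  `|f - B un| <= `|f - B un + t *: B un|.
Proof.
move=> [unU unmin]; have := unmin ((1 - t) *: un) (rpredZ _ unU).
by rewrite linearZ /= scalerBl scale1r opprB [f + (_ - _)]addrCA [t *: _ + _]addrC.
Qed.

(** Two distinct residuals of the same norm, scaled to the unit sphere, would give the midpoint of
    [un] and [un'] a strictly smaller residual. *)
Lemma residual_minimizer_unique un un' : strictly_convex (dual V) ->
  residual_minimizer B f Un un -> residual_minimizer B f Un un' ->
  B un = B un'.
Proof.
move=> sc [unU unmin] [un'U un'min].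
suff : f - B un = f - B un' by move=> /addrI/oppr_inj.
apply: contrapT; set r := f - B un; set r' := f - B un' => rr'.
have nrr' : `|r'| = `|r| by apply/eqP; rewrite eq_le unmin ?un'min.
have r0 : `|r| != 0.
  apply/eqP => r0; apply: rr'; rewrite (normr0_eq0 r0).
  by move: nrr'; rewrite r0 => /normr0_eq0 ->.
have n1 (x : dual V) : `|x| = `|r| -> `|(`|r|^-1) *: x| = 1.
  by move=> xr; rewrite normrZ normfV normr_id xr mulVf.
have h : 0 < (2^-1 : R) < 1 by rewrite invr_gt0 ltr0n invf_lt1 ?ltr0n ?ltr1n.
have neq : `|r|^-1 *: r <> `|r|^-1 *: r'.
  by move/(congr1 (fun x => `|r| *: x)); rewrite !scalerKV.
have := sc _ _ _ neq (n1 r erefl) (n1 r' nrr') h.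
have -> : (1 - 2^-1 : R) = 2^-1 by lra.
rewrite !scalerA !(mulrC 2^-1) -!scalerA -scalerDr normrZ normfV normr_id.
rewrite mulrC ltr_pdivrMr ?mul1r; last by rewrite lt_def r0 normr_ge0.
apply/negP; rewrite -leNgt.
have := unmin _ (rpredD (rpredZ 2^-1 unU) (rpredZ 2^-1 un'U)).
rewrite linearD !linearZ /= -/r.
suff -> : f - (2^-1 *: B un + 2^-1 *: B un') = 2^-1 *: r + 2^-1 *: r' by [].
rewrite !scalerBr addrACA -scalerDl opprD.
have -> : (2^-1 + 2^-1 : R) = 1 by lra.
by rewrite scale1r.
Qed.

End ResidualMinimization.

Theorem theorem3 (R : realType) (U V : completeNormedModType R)
  (hV : dim_ge V 2)
  (B : {linear U -> dual V}) (gammaB MB : R)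
  (hM : 0 < MB) (hgamma : 0 < gammaB)
  (hB : forall w : U, gammaB * `|w| <= `|B w| /\ `|B w| <= MB * `|w|)
  (f : dual V) (Un : submodClosed U) (hUn : finite_dim (subspace_of Un)) :
  [/\ (* (i) *)
      exists un : U, residual_minimizer B f Un un,
      (* (ii) *)
      forall un : U, residual_minimizer B f Un un ->
        (`|un|%:E <= C_BM (dual V) * (gammaB^-1)%:E * `|f|%:E)%E /\
        (`|un|%:E <= (1 + C_AO V) * (gammaB^-1)%:E * `|f|%:E)%E,
      (* (iii) *)
      strictly_convex (dual V) ->
        exists! un : U, residual_minimizer B f Un un
    & (* (iv) *)
      forall u : U, B u = f ->
        forall un : U, residual_minimizer B f Un un ->
          `|u - un| <= gammaB^-1 * `|f - B un| /\
          gammaB^-1 * `|f - B un| <=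
            MB / gammaB * inf [set `|u - wn| | wn in [set` Un]]].
Proof.
have gB w : `|w| <= gammaB^-1 * `|B w|.
  by rewrite ler_pdivlMl//; exact: (hB w).1.
have Binj u v : B u = B v -> u = v.
  move=> Buv; apply/subr0_eq/normr0_eq0/eqP; rewrite eq_le normr_ge0 andbT.
  by rewrite (le_trans (gB _))// linearB Buv /= subrr normr0 mulr0.
split.
- exact: residual_minimizer_exists.
- move=> un unmin; set g := B un.
  have rg t := residual_minimizer_ortho t unmin.
  (* Both bounds reduce to one for [g] with [f] nonzero: if [f = 0], taking [t = 1] in [rg] forces
     [g = 0], hence [un = 0]. *)
  suff H (C : \bar R) : (f != 0 -> (`|g|%:E <= C * `|f|%:E)%E) ->
      (`|un|%:E <= C * (gammaB^-1)%:E * `|f|%:E)%E.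
    have fE : f = f - B un + g by rewrite subrK.
    split; apply: H; rewrite {1 2}fE => f0.
      exact: C_BM_projection_bound.
    exact: C_AO_projection_boundE.
  have [f0 _|f0 /(_ isT) gC] := eqVneq f 0.
    have g0 : g = 0.
      have := rg 1; rewrite scale1r subrK f0 normr0 normr_le0 sub0r oppr_eq0.
      by move=> /eqP.
    have := gB un; rewrite -/g g0 normr0 mulr0 normr_le0 => /eqP ->.
    by rewrite f0 !normr0 mule0.
  rewrite muleAC [leRHS]muleC.
  apply: le_trans (lee_wpmul2l _ gC); last by rewrite lee_fin invr_ge0 ltW.
  by rewrite -EFinM lee_fin; exact: gB.
- move=> sc; have [un unmin] := residual_minimizer_exists B f hUn.
  exists un; split=> // un' un'min; apply: Binj.
  exact: residual_minimizer_unique unmin un'min.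
- move=> u Bu un [_ unmin]; split.
    by rewrite (le_trans (gB _))// linearB /= Bu.
  (* After cancelling [gammaB^-1], each [w] is handled by minimality and [f - B w = B (u - w)]. *)
  rewrite mulrC mulrAC ler_wpM2r ?invr_ge0 ?(ltW hgamma)//.
  rewrite -ler_pdivrMl//; apply: lb_le_inf.
    by exists `|u - 0|, 0 => //=; exact: rpred0.
  move=> _ [w wU <-]; rewrite ler_pdivrMl// (le_trans (unmin w wU))//.
  by rewrite -Bu -linearB; exact: (hB _).2.
Qed.
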